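(* For every positive integer $k$ there exists a constant $A_k$ such that for every tree $\mathcal{S}$ on $s$ vertices and every integer $t\ge 2$, we have $f(\mathcal{S},P_t)\le A_k\, s\, t\, \alpha_k(t)$.
   Context: $P_t$ denotes the path on $t$ vertices. For graphs $\mathcal{S},\mathcal{T}$, the constrained Ramsey number $f(\mathcal{S},\mathcal{T})$ is the least $N$ such that every edge-coloring of $K_N$ (with an arbitrary number of colors) contains a monochromatic copy of $\mathcal{S}$ (all edges the same color) or a rainbow copy of $\mathcal{T}$ (all edges distinct colors). The inverse Ackermann hierarchy: $\alpha_1(t)=\lceil t/2\rceil$; for $k\ge2$, $\alpha_k(1)=0$ and $\alpha_k(t)=\min\{r:\alpha_{k-1}^{(r)}(t)=1\}$, where $\alpha_{k-1}^{(r)}$ is the $r$-fold iterate of $\alpha_{k-1}$. *)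

(* Defs.v *)
From mathcomp Require Import all_boot.

Set Implicit Arguments.
Unset Strict Implicit.
Unset Printing Implicit Defensive.

Record sgraph := SGraph {
  vertex :> finType;
  adj : rel vertex;
  adj_sym : symmetric adj;
  adj_irrefl : irreflexive adj }.

Definition edges (G : sgraph) : {set {set G}} :=
  [set [set x; y] | x : G, y : G in adj x].

(* [ucycle] also accepts the degenerate cycles of size 0 and, when x and y are
   adjacent, [:: x; y]; genuine cycles are those of size at least 3. *)
Definition acyclic (G : sgraph) : Prop :=
  forall p : seq G, ucycle (@adj G) p -> size p < 3.

Definition connected (G : sgraph) : Prop :=
  0 < #|G| /\ forall x y : G, connect (@adj G) x y.

Definition is_tree (G : sgraph) : Prop := connected G /\ acyclic G.

Definition path_adj (t : nat) : rel 'I_t :=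
  fun i j => (i.+1 == j :> nat) || (j.+1 == i :> nat).

Lemma path_adj_sym t : symmetric (@path_adj t).
Proof. by move=> i j; rewrite /path_adj orbC. Qed.

Lemma path_adj_irrefl t : irreflexive (@path_adj t).
Proof. by move=> i; rewrite /path_adj orbb gtn_eqF. Qed.

Definition path_graph (t : nat) : sgraph :=
  SGraph (@path_adj_sym t) (@path_adj_irrefl t).

(* An edge-colouring of K_N is a function on sets of vertices; only its values
   on two-element sets matter, since a copy of H in K_N is an injection phi of
   the vertices of H, under which the edge e becomes the pair phi @: e. *)
Definition has_mono_copy (H : sgraph) (N : nat) (C : eqType)
    (c : {set 'I_N} -> C) : Prop :=
  exists2 phi : H -> 'I_N, injective phi &
    {in edges H &, forall e e' : {set H}, c (phi @: e) = c (phi @: e')}.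

Definition has_rainbow_copy (H : sgraph) (N : nat) (C : eqType)
    (c : {set 'I_N} -> C) : Prop :=
  exists2 phi : H -> 'I_N, injective phi &
    {in edges H &, injective (fun e : {set H} => c (phi @: e))}.

Definition constrained_ramsey_prop (S T : sgraph) (N : nat) : Prop :=
  forall (C : eqType) (c : {set 'I_N} -> C),
    has_mono_copy S c \/ has_rainbow_copy T c.

(* f(S, T) = N *)
Definition is_constrained_ramsey (S T : sgraph) (N : nat) : Prop :=
  constrained_ramsey_prop S T N /\
  forall M, constrained_ramsey_prop S T M -> N <= M.

(* The least r with iter r g t = 1, searched for among r < t: this range is
   large enough when 1 <= g x < x for all x >= 2 (see [alphaP]). *)
Definition steps_to_one (g : nat -> nat) (t : nat) : nat :=
  find (fun r => iter r g t == 1) (iota 0 t).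

(* The hierarchy starts at k = 1; [alpha 0] is a dummy value. *)
Fixpoint alpha (k : nat) : nat -> nat :=
  match k with
  | 0 => id
  | 1 => uphalf
  | k'.+1 => steps_to_one (alpha k')
  end.

Lemma alpha1E t : alpha 1 t = uphalf t. Proof. by []. Qed.

Lemma steps_to_oneP (g : nat -> nat) t :
    (forall x, 1 < x -> 0 < g x < x) -> 0 < t ->
  [/\ iter (steps_to_one g t) g t = 1,
      forall r, iter r g t = 1 -> steps_to_one g t <= r
    & steps_to_one g t < t].
Proof.
move=> gP t_gt0.
have [r r_lt r1] : exists2 r, r < t & iter r g t = 1.
  elim/ltn_ind: t t_gt0 => t IHt t_gt0.
  have [t_le1|t_gt1] := leqP t 1.
    by exists 0 => //=; apply/eqP; rewrite eqn_leq t_le1.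
  have /andP[g_gt0 g_lt] := gP _ t_gt1.
  have [r r_lt r1] := IHt _ g_lt g_gt0.
  by exists r.+1; [apply: leq_ltn_trans g_lt | rewrite iterSr].
have hasr : has (fun r => iter r g t == 1) (iota 0 t).
  by apply/hasP; exists r; rewrite ?mem_iota ?r1.
have find_lt : steps_to_one g t < t by move: hasr; rewrite has_find size_iota.
split=> // [|q q1].
  by have /eqP := nth_find 0 hasr; rewrite nth_iota.
rewrite leqNgt; apply/negP => q_lt.
have := before_find 0 q_lt.
by rewrite nth_iota ?(ltn_trans q_lt) // add0n q1.
Qed.

Lemma alpha_bounds k x : 0 < k -> 1 < x -> 0 < alpha k x < x.
Proof.
case: k => // k _; elim: k x => [|k IHk] x x_gt1.
  rewrite alpha1E; case: x x_gt1 => [|[|x]] //= _.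
  by rewrite !ltnS uphalfE leq_half_double -addnn ltnS leq_addr.
have [s1 _ s_lt] := steps_to_oneP IHk (ltnW x_gt1).
rewrite -[alpha k.+2 x]/(steps_to_one (alpha k.+1) x) s_lt andbT lt0n.
apply/eqP => s0; move: s1.
by rewrite s0 /= => x1; rewrite x1 in x_gt1.
Qed.

Lemma alphaP k t : 1 < k -> 0 < t ->
  iter (alpha k t) (alpha k.-1) t = 1 /\
  forall r, iter r (alpha k.-1) t = 1 -> alpha k t <= r.
Proof.
case: k => [|[|k]] // _ t_gt0.
have [] := @steps_to_oneP (alpha k.+1) t _ t_gt0; last by [].
by move=> x; apply: alpha_bounds.
Qed.

Lemma alpha_1 k : 1 < k -> alpha k 1 = 0.
Proof. by case: k => [|[|k]]. Qed.

(* Main.v *)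
(* In fact f(S, P_t) <= 1200 s t, and alpha_k(t) >= 1 for t >= 2.

   Take a colouring without a monochromatic S and without a rainbow P_t; every
   colour class is then sparse. Since rainbow paths are short, every large vertex
   set has a vertex joined to nearly all of it in one colour. Collecting such
   vertices gives sets V1 and Y of order s t each, where v in V1 sends a colour
   c v to most of Y, and the fibres of c have size O(s). Rainbow pieces in V1
   using pairwise different colours can be linked through Y, so their total
   length is less than t. Hence, after deleting the fibres of O(t) vertices, an
   edge uv inside V1 has colour c u or c v, or one of O(t) rogue colours.

   A piece is a rogue edge followed by a path directed by c. Pick disjoint pieces
   greedily, longest first; let n_L be the number of those of length at least L,
   so that the sum of the n_L is less than t. Among the remaining vertices, let
   H_L be the set of those starting a directed path of length L. Rogue edges
   inside H_L only have the n_L rogue colours of pieces at least that long, so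
   H_L minus H_2L, which contains no large tournament, has O(L (s + s n_L))
   vertices. Summing over L = 1, 2, 4, ... up to t, all but O(s t) of the
   vertices start a directed, hence rainbow, path on t vertices: contradiction. *)

Require Import Defs.
From mathcomp Require Import all_boot zify.
From Stdlib Require Import Classical_Prop.

Set Implicit Arguments.
Unset Strict Implicit.
Unset Printing Implicit Defensive.

(** * Sparse graphs: degree sums and independent sets *)

Section Degrees.
Variable V : finType.
Implicit Types (e : rel V) (U B I : {set V}).

Definition deg e U x := #|[set y in U | e x y]|.

(** Average degree at most [D] inside every vertex subset: a condition that adds up over unions of
    graphs and tolerates single vertices of huge degree. *)
Definition sparse e D := forall U, \sum_(x in U) deg e U x <= D * #|U|.

Lemma degE e U x : deg e U x = \sum_(y in U) e x y.
Proof.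
rewrite /deg -sum1_card big_mkcond [RHS]big_mkcond; apply: eq_bigr => y _.
by rewrite !inE; case: (y \in U); case: (e x y).
Qed.

Lemma eq_sparse e1 e2 D : e1 =2 e2 -> sparse e1 D -> sparse e2 D.
Proof.
move=> eqe spD U; apply: leq_trans (spD U); apply: leq_sum => x _.
by apply: subset_leq_card; apply/subsetP => y; rewrite !inE eqe.
Qed.

Lemma sparseU e1 e2 D1 D2 : sparse e1 D1 -> sparse e2 D2 ->
  sparse (fun x y => e1 x y || e2 x y) (D1 + D2).
Proof.
move=> sp1 sp2 U; rewrite mulnDl; apply: leq_trans (leq_add (sp1 U) (sp2 U)).
rewrite -big_split /=; apply: leq_sum => x _.
apply: leq_trans (leq_card_setU _ _); apply: subset_leq_card.
by apply/subsetP => y; rewrite !inE -andb_orr.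
Qed.

Lemma sparse_deg e D : (forall x, #|[set y | e x y]| <= D) -> sparse e D.
Proof.
move=> dD U; rewrite mulnC -sum_nat_const; apply: leq_sum => x _.
apply: leq_trans (dD x); apply: subset_leq_card.
by apply/subsetP => y; rewrite !inE => /andP[].
Qed.

Lemma sum_deg_rem e U x : symmetric e -> x \in U ->
  \sum_(y in U) deg e U y <= \sum_(y in U :\ x) deg e (U :\ x) y + (deg e U x).*2.
Proof.
move=> e_sym xU; rewrite (big_setD1 x) //=.
suff : \sum_(y in U :\ x) deg e U y <=
    \sum_(y in U :\ x) deg e (U :\ x) y + \sum_(y in U :\ x) e x y.
  by have := degE e U x; rewrite (big_setD1 x) //=; lia.
rewrite -big_split /=; apply: leq_sum => y; rewrite !inE => /andP[yx yU].
rewrite /deg (cardsD1 x [set z in U | e y z]) !inE xU /= addnC e_sym leq_add2r.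
by apply: subset_leq_card; apply/subsetP => z; rewrite !inE andbA.
Qed.

(** Strip off vertices of degree at most [s] one by one: each removal costs the degree sum that
    degree at most twice, once at the vertex and once over its neighbours. *)
Lemma sparse_of_low_degree e s : symmetric e ->
    (forall U, U != set0 -> exists2 x, x \in U & deg e U x <= s) ->
  sparse e s.*2.
Proof.
move=> e_sym low U; have [n] := ubnP #|U|; elim: n U => // n IH U leUn.
have [->|U0] := eqVneq U set0; first by rewrite big_set0.
have [x xU dx] := low _ U0; apply: leq_trans (sum_deg_rem e_sym xU) _.
have := cardsD1 x U; rewrite xU => cU.
have := IH (U :\ x); rewrite ltnS in leUn; move/(_ _)=> H.
have {}H := H ltac:(lia).
rewrite -!muln2 in dx H *; nia.
Qed.

(** Greedy choice: a vertex of at most average degree joins [I] and leaves [B] together with its at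
    most [D] neighbours. *)
Lemma indep_set e D B : symmetric e -> sparse e D ->
  exists I, [/\ I \subset B, {in I &, forall x y, x != y -> ~~ e x y}
    & #|B| <= D.+1 * #|I|].
Proof.
move=> e_sym spD; have [n] := ubnP #|B|; elim: n B => // n IH B leBn.
have [->|/set0Pn[x0 x0B]] := eqVneq B set0.
  by exists set0; rewrite sub0set cards0; split=> // x y; rewrite inE.
have [x xB dx] : exists2 x, x \in B & deg e B x <= D.
  apply/exists_inP; apply: contraTT (spD B); rewrite negb_exists_in => /forall_inP H.
  rewrite -ltnNge mulnC -sum_nat_const.
  have lt y : y \in B -> D.+1 <= deg e B y by move/H; rewrite -ltnNge.
  have : \sum_(y in B) D.+1 <= \sum_(y in B) deg e B y by apply: leq_sum.
  rewrite !sum_nat_const.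
  have : 0 < #|B| by apply/card_gt0P; exists x0.
  by rewrite mulnS; lia.
pose B' := B :\ x :\: [set y in B | e x y].
have cB : #|B| <= #|B'| + D.+1.
  have := cardsD1 x B; rewrite xB; have := cardsID [set y in B | e x y] (B :\ x).
  have : #|(B :\ x) :&: [set y in B | e x y]| <= D.
    by apply: leq_trans dx; apply: subset_leq_card; apply: subsetIr.
  rewrite /B'; lia.
have sB : #|B'| < #|B|.
  apply: proper_card; apply/properP; split; first by apply/subsetP => y; rewrite !inE => /and3P[].
  by exists x; rewrite // !inE eqxx andbF.
have [|I [IB' Ind cI]] := IH B'; first by apply: leq_trans sB _.
have xI : x \notin I by apply: contraL xB => /(subsetP IB'); rewrite !inE eqxx andbF.
have adjx y : y \in I -> ~~ e x y.
  by move=> /(subsetP IB'); rewrite !inE; case: (e x y); rewrite ?andbF // andbT; case: (y \in B); rewrite ?andbF.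
exists (x |: I); split.
- apply/subsetP => y; rewrite !inE => /orP[/eqP->//|/(subsetP IB')].
  by rewrite !inE => /and3P[].
- move=> y z; rewrite !inE => /orP[/eqP->|yI] /orP[/eqP->|zI].
  + by rewrite eqxx.
  + by move=> _; apply: adjx.
  + by move=> _; rewrite e_sym; apply: adjx.
  + exact: Ind.
- by rewrite cardsU1 xI mulnDr; lia.
Qed.

End Degrees.

(** * Tournaments: directed Hamiltonian paths and large out-degrees *)

Section Redei.
Variables (T : eqType) (arc : rel T).

(** [x] goes in front of the first vertex of [s] to which it has an arc, or at the end; its
    predecessor then has an arc to [x]. *)
Lemma path_insert x y s : path arc y s -> arc y x ->
    {in s, forall z, arc x z || arc z x} ->
  exists2 s', perm_eq s' (x :: s) & path arc y s'.
Proof.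
elim: s y => [|z s IH] y /=; first by move=> _ yx _; exists [:: x]; rewrite //= yx.
case/andP=> yz pz yx tot; have [xz|nxz] := boolP (arc x z).
  by exists [:: x, z & s]; rewrite //= yx xz.
have zx : arc z x by have := tot z (mem_head _ _); rewrite (negPf nxz).
have [|s' ps' pzs'] := IH _ pz zx; first by move=> w ws; apply: tot; rewrite inE ws orbT.
exists (z :: s'); last by rewrite /= yz.
by rewrite perm_sym (perm_catCA [:: x] [:: z] s) /= perm_cons perm_sym.
Qed.

Lemma redei s : uniq s -> {in s &, forall x y, x != y -> arc x y || arc y x} ->
  exists2 s', perm_eq s' s & sorted arc s'.
Proof.
elim: s => [|x s IH] /=; first by exists [::].
case/andP=> xs us tot; have [|s' ps' srt] := IH us.
  by move=> y z ys zs; apply: tot; rewrite inE ?ys ?zs orbT.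
have tx z : z \in s' -> arc x z || arc z x.
  rewrite (perm_mem ps') => zs; apply: tot; rewrite ?mem_head ?inE ?zs ?orbT //.
  by apply: contraNneq xs => ->.
case: s' srt ps' tx => [|y s'] /= srt ps' tx; first by exists [:: x]; rewrite // perm_cons.
have [xy|nxy] := boolP (arc x y).
  by exists [:: x, y & s']; rewrite ?perm_cons //= xy.
have yx : arc y x by have := tx y (mem_head _ _); rewrite (negPf nxy).
have [|s2 ps2 pys2] := path_insert srt yx.
  by move=> z zs; apply: tx; rewrite inE zs orbT.
exists (y :: s2) => //.
apply: (@perm_trans _ (y :: x :: s')); first by rewrite perm_cons.
by rewrite (perm_catCA [:: y] [:: x] s') /= perm_cons.
Qed.

End Redei.

(** Averaging: every pair in [I] carries an arc, so some out-degree is at least half of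
    [#|I| - 1]. *)
Lemma max_outdegree (V : finType) (arc : rel V) (I : {set V}) : 0 < #|I| ->
    {in I &, forall x y, x != y -> arc x y || arc y x} ->
  exists2 v, v \in I & #|I| <= (#|[set y in I :\ v | arc v y]|).*2.+1.
Proof.
move=> I0 tot.
apply/exists_inP; apply: contraT; rewrite negb_exists_in => /forall_inP H.
pose f x y := ((y != x) && arc x y : nat).
have outE x : #|[set y in I :\ x | arc x y]| = \sum_(y in I) f x y.
  rewrite -sum1_card big_mkcond [RHS]big_mkcond; apply: eq_bigr => y _.
  by rewrite /f !inE; case: (y \in I); case: (y != x); case: (arc x y).
have : \sum_(x in I) #|I| <= \sum_(x in I) \sum_(y in I) (f x y + f y x + (y == x)).
  apply: leq_sum => x xI; rewrite -sum1_card; apply: leq_sum => y yI.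
  rewrite /f; have [_|xy] := eqVneq x y; first by rewrite addn1.
  by have := tot _ _ xI yI xy; case: (arc x y); case: (arc y x).
have -> : \sum_(x in I) \sum_(y in I) (f x y + f y x + (y == x))
   = \sum_(x in I) (\sum_(y in I) f x y).*2.+1.
  transitivity (\sum_(x in I) (\sum_(y in I) f x y + \sum_(y in I) f y x + 1)).
    apply: eq_bigr => x xI; rewrite !big_split /=; congr (_ + _ + _).
    by rewrite (bigD1 x xI) /= eqxx big1 // => y /andP[_ /negPf->].
  rewrite !big_split /= [X in _ + X + _]exchange_big /= -!big_split /=.
  by apply: eq_bigr => x _; rewrite addnn addn1.
have : \sum_(x in I) (\sum_(y in I) f x y).*2.+2 <= \sum_(x in I) #|I|.
  by apply: leq_sum => x /H; rewrite -ltnNge outE.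
rewrite (eq_bigr (fun x => (\sum_(y in I) f x y).*2.+1 + 1)); last by move=> x _; rewrite addn1.
rewrite big_split /= sum1_card; lia.
Qed.

(** * Trees inside graphs of large minimum degree *)

Lemma tree_embedding (S : sgraph) (V : finType) (e : rel V) (U : {set V}) :
    is_tree S -> symmetric e -> U != set0 ->
    {in U, forall x, #|S| <= deg e U x} ->
  exists2 phi : S -> V, injective phi & forall x y, adj x y -> e (phi x) (phi y).
Proof.
case=> [[S0 conn] acyc] e_sym /set0Pn[w0 w0U] dU.
pose adjIn (A : {set S}) := [rel x y | [&& adj x y, x \in A & y \in A]].
(* Grow a connected part [A] of the tree together with its embedding, one vertex at a time. *)
suff step n : 0 < n <= #|S| -> exists A : {set S}, [/\ #|A| = n,
    {in A &, forall x y, connect (adjIn A) x y} & exists phi : S -> V,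
    [/\ {in A, forall x, phi x \in U}, {in A &, injective phi}
      & {in A &, forall x y, adj x y -> e (phi x) (phi y)}]].
  have [|A [cA _ [phi [_ inj hom]]]] := step #|S|; first by rewrite S0 leqnn.
  have AT x : x \in A.
    by have /eqP-> : A == setT; [rewrite eqEcard subsetT cardsT cA /= | rewrite inE].
  by exists phi => [x y|x y]; [apply: inj | apply: hom].
elim: n => // n IH /andP[_ ltn].
have [->|n0] := posnP n.
  have /card_gt0P[x0 _] := S0.
  exists [set x0]; split; first by rewrite cards1.
    by move=> x y /set1P-> /set1P->; apply: connect0.
  exists (fun=> w0); split=> // x y /set1P-> /set1P-> //.
  by rewrite adj_irrefl.
have [|A [cA connA [phi [phiU inj hom]]]] := IH; first by rewrite n0 ltnW.
have [a aA [v vA av]] : exists2 a, a \in A & exists2 v, v \notin A & adj a v.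
  have [H|/exists_inPn H] := boolP [exists a in A, exists v in ~: A, adj a v].
    case/exists_inP: H => a aA /exists_inP[v vA av].
    by exists a => //; exists v => //; move: vA; rewrite inE.
  have clA : closed (@adj S) A.
    have half x y : adj x y -> x \in A -> y \in A.
      move=> xy xA; apply: contraT => yA.
      have /exists_inPn/(_ y) := H x xA.
      by rewrite inE yA xy => /(_ isT).
    move=> x y xy; apply/idP/idP; apply: half => //.
    by rewrite adj_sym.
  have /card_gt0P[a0 a0A] : 0 < #|A| by rewrite cA.
  have : #|A| = #|S|.
    by apply: eq_card => x; rewrite -(closed_connect clA (conn a0 x)) a0A.
  by rewrite cA => nS; rewrite nS ltnn in ltn.
(* A second neighbour [b] of [v] in [A] would close a cycle: [v], then a path inside [A] from [a] to
   [b]. So only the edge [av] has to be respected. *)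
have uniq_nb b : b \in A -> adj b v -> b = a.
  move=> bA bv; apply/eqP; apply: contraT => ba.
  case/connectP: (connA _ _ aA bA) => p0 path_p0 lastb.
  move: path_p0 lastb; case/shortenP => p path_p uniq_p _ lastb.
  have padj : path (@adj S) a p by apply: sub_path path_p => x y /and3P[].
  have pA : {subset p <= A}.
    move=> x xp; move: path_p; case/splitPr: xp => p1 p2.
    by rewrite cat_path /= => /and3P[_ /and3P[]].
  have /acyc : ucycle (@adj S) [:: v, a & p].
    apply/andP; split; first by rewrite /= rcons_path -lastb adj_sym av padj bv.
    rewrite cons_uniq uniq_p andbT inE negb_or; apply/andP; split.
      by apply: contraNneq vA => ->.
    by apply: contra vA => /pA.
  by case: p lastb {path_p uniq_p padj pA} => //= ba'; rewrite ba' eqxx in ba.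
have [w] : exists w, (w \in [set y in U | e (phi a) y]) && (w \notin phi @: A).
  apply/existsP; apply: contraT; rewrite negb_exists => /forallP H.
  have := dU _ (phiU _ aA); rewrite leqNgt; apply: contraNT => _.
  apply: (leq_ltn_trans _ ltn); rewrite -cA; apply: leq_trans (leq_imset_card phi _).
  apply: subset_leq_card; apply/subsetP => y yU.
  by have := H y; rewrite yU negbK.
rewrite inE => /andP[/andP[wU ew] wA].
exists (v |: A); split; first by rewrite cardsU1 vA cA.
  have mono x y : x \in A -> y \in A -> connect (adjIn (v |: A)) x y.
    move=> xA yA; apply: connect_sub (connA _ _ xA yA) => {xA yA}{}x {}y /and3P[xy xA yA].
    by apply: connect1; rewrite /= xy !inE xA yA !orbT.
  have av1 : connect (adjIn (v |: A)) a v.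
    by apply: connect1; rewrite /= av !inE aA eqxx orbT.
  have va1 : connect (adjIn (v |: A)) v a.
    by apply: connect1; rewrite /= adj_sym av !inE aA eqxx orbT.
  move=> x y; rewrite !inE => /orP[/eqP->|xA] /orP[/eqP->|yA].
  - exact: connect0.
  - exact: connect_trans va1 (mono _ _ aA yA).
  - exact: connect_trans (mono _ _ xA aA) av1.
  - exact: mono.
have nv x : x \in A -> (x == v) = false by move=> xA; apply: contraNF vA => /eqP<-.
have nw x : x \in A -> phi x <> w by move=> xA xw; case/negP: wA; rewrite -xw imset_f.
exists (fun x => if x == v then w else phi x); split.
- by move=> x; rewrite !inE => /orP[/eqP->|xA]; rewrite ?eqxx ?nv // phiU.
- move=> x y; rewrite !inE => /orP[/eqP->|xA] /orP[/eqP->|yA]; rewrite ?eqxx ?nv //.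
  + by move/esym/nw => /(_ yA).
  + by move/nw => /(_ xA).
  + exact: inj.
- move=> x y; rewrite !inE => /orP[/eqP->|xA] /orP[/eqP->|yA]; rewrite ?eqxx ?nv //.
  + by rewrite adj_irrefl.
  + by rewrite adj_sym => /(uniq_nb _ yA)->; rewrite e_sym.
  + by move/(uniq_nb _ xA)->.
  + exact: hom.
Qed.

(** A vertex set without a vertex of degree at most [s] in colour [a] would contain the tree in that
    colour. *)
Lemma sparse_color (S : sgraph) s N (C : eqType) (c : {set 'I_N} -> C) a :
    is_tree S -> #|S| = s -> ~ has_mono_copy S c ->
  sparse [rel x y | (x != y) && (c [set x; y] == a)] s.*2.
Proof.
move=> treeS <- nmono; apply: sparse_of_low_degree => [x y|U U0].
  by rewrite /= eq_sym setUC.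
apply/exists_inP; apply: contraT; rewrite negb_exists_in => /forall_inP H.
case: nmono.
have [||phi inj hom] := tree_embedding treeS _ U0 (e := [rel x y | (x != y) && (c [set x; y] == a)]).
- by move=> x y; rewrite /= eq_sym setUC.
- by move=> x /H; rewrite -ltnNge => /ltnW.
have col_a E : E \in edges S -> c (phi @: E) = a.
  case/imset2P => x y _ xy ->.
  by have /andP[_ /eqP<-] := hom _ _ xy; rewrite imsetU1 imset_set1.
by exists phi => // E E' /col_a-> /col_a->.
Qed.

(** * Short rainbow paths force dominated vertices *)

Section Rainbow.
Variables (V : finType) (C : eqType) (col : V -> V -> C) (s t : nat).

Definition rainbow x p := uniq (x :: p) && uniq (pairmap col x p).

Hypothesis col_sym : forall x y, col x y = col y x.
Hypothesis s_gt0 : 0 < s.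
Hypothesis color_sparse :
  forall a, sparse [rel x y | (x != y) && (col x y == a)] s.*2.
Hypothesis rainbow_short : forall x p, rainbow x p -> (size p).+1 < t.

Lemma colors_sparse (R : seq C) :
  sparse [rel x y | (x != y) && (col x y \in R)] (s.*2 * size R).
Proof.
elim: R => [|a R IH] /=.
  by move=> U; rewrite muln0 big1 // => x _; apply: eq_card0 => y; rewrite !inE /= ?in_nil !andbF.
rewrite mulnS; apply: eq_sparse (sparseU (color_sparse a) IH) => x y.
by rewrite /= inE andb_orr.
Qed.

(* If no vertex of X is dominated by one colour, a rainbow path in X can be
   extended greedily: go to a vertex at which the used colours are rare, so that
   they still leave room after the colour of the new edge is added to them. *)
Lemma dominated_vertex (X : {set V}) : 0 < t -> 600 * s * t <= #|X| ->
  exists2 x, x \in X & exists a, 8 * #|[set y in X | col x y != a]| <= #|X|.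
Proof.
move=> t_gt0 leX.
have [/exists_inP[x xX /existsP[z H]]|/exists_inPn nodom] :=
    boolP [exists x in X, exists z, 8 * #|[set y in X | col x y != col x z]| <= #|X|].
  by exists x => //; exists (col x z).
have st_gt0 : 0 < s * t by rewrite muln_gt0 s_gt0.
pose used (u : seq C) := [rel x y | (x != y) && (col x y \in u)].
(* Outside [Bl] the old colours reach at most 1/24 of [X] and, without domination, the new colour
   less than 21/24; hence 22. The other 2/24 of [X] is at least 50st vertices, more than the 48st of
   [Bl] and the t of the path. *)
suff H k : k < t -> exists x p, [/\ rainbow x p, size p = k, {subset x :: p <= X}
    & 24 * deg (used (pairmap col x p)) X x <= 22 * #|X|].
  have [|x [p [rp sp _ _]]] := H t.-1; first by rewrite prednK.
  by have := rainbow_short rp; rewrite sp prednK // ltnn.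
elim: k => [_|k IH ltk].
  have /card_gt0P[x xX] : 0 < #|X| by apply: leq_trans leX; rewrite -mulnA muln_gt0.
  exists x, [::]; split=> //; first by move=> y; rewrite inE => /eqP->.
  rewrite (_ : deg _ _ _ = 0) ?muln0 //.
  by apply: eq_card0 => y; rewrite !inE /= ?in_nil !andbF.
have [x [p [rp sp pX dx]]] := IH (ltnW ltk).
set u := pairmap col x p in dx; have su : size u = k by rewrite size_pairmap.
pose Bl := [set y in X | #|X| < 24 * deg (used u) X y].
(* Markov's inequality for the degree sum bounded by [colors_sparse]. *)
have cBl : #|Bl| <= 48 * (s * t).
  have : #|Bl| * #|X| <= 24 * (s.*2 * k * #|X|).
    rewrite -su; apply: leq_trans (leq_mul (leqnn 24) (colors_sparse u X)).
    rewrite big_distrr /= -sum_nat_const (bigID (mem Bl) (mem X)) /=.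
    apply: leq_trans (leq_addr _ _).
    rewrite [leqRHS](eq_bigl (mem Bl)); last by move=> y; rewrite /= !inE; case: (y \in X).
    by apply: leq_sum => y; rewrite inE => /andP[_ /ltnW].
  rewrite !mulnA leq_mul2r => /orP[/eqP X0|]; first by move: leX; rewrite X0; lia.
  by rewrite -muln2; nia.
have [y] : exists y, [&& y \in X, y \notin x :: p, y \notin Bl & ~~ used u x y].
  apply/existsP; apply: contraT; rewrite negb_exists => /forallP H.
  have sub : X \subset [set z in x :: p] :|: Bl :|: [set z in X | used u x z].
    apply/subsetP => y yX; have := H y.
    rewrite yX !in_setU; case: (y \in Bl) => [|/=]; first by rewrite orbT.
    by rewrite !in_set orbF yX; case: (y \in x :: p) => //=; rewrite negbK.
  have := subset_leq_card sub.
  have [+ _] := leq_card_setU ([set z in x :: p] :|: Bl) [set z in X | used u x z].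
  have [+ _] := leq_card_setU [set z in x :: p] Bl.
  have : #|[set z in x :: p]| <= t.
    by rewrite cardsE; apply: (leq_trans (card_size _)); rewrite /= sp ltnW.
  have : t <= s * t by rewrite leq_pmull.
  rewrite -[#|[set z in X | used u x z]|]/(deg (used u) X x) -mulnA in leX *.
  by move: dx cBl; lia.
case/and4P=> yX yp yBl nuxy; exists y, (x :: p).
have xy : x != y by apply: contraNneq yp => ->; rewrite mem_head.
have nu : col y x \notin u by move: nuxy; rewrite /= xy /= col_sym.
have /andP[up uc] := rp.
split; first by rewrite /rainbow cons_uniq yp up /= nu uc.
- by rewrite /= sp.
- by move=> z; rewrite inE => /orP[/eqP->//|/pX].
have dy : 24 * deg (used u) X y <= #|X| by move: yBl; rewrite inE yX /= -leqNgt.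
have /existsPn/(_ x) := nodom _ yX; rewrite -ltnNge => ndy.
have cX : #|[set z in X | col y z == col y x]| + #|[set z in X | col y z != col y x]| = #|X|.
  rewrite -[RHS](cardsID [set z | col y z == col y x] X).
  by congr (_ + _); apply: eq_card => z; rewrite !inE // andbC.
have : deg (used (col y x :: u)) X y <= deg (used u) X y + #|[set z in X | col y z == col y x]|.
  apply: leq_trans (leq_card_setU _ _); apply: subset_leq_card; apply/subsetP => z.
  by rewrite !inE /= in_cons => /and3P[-> -> /orP[->|->]]; rewrite ?orbT.
rewrite -[pairmap col y (x :: p)]/(col y x :: u).
move: dy ndy cX; lia.
Qed.

(** Dominated vertices are moved from the complement into [V1] one by one. Measuring against [#|V|]
    keeps the earlier bounds valid while the complement shrinks. *)
Lemma hub m : 0 < t -> 600 * s * t + m <= #|V| ->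
  exists V1 : {set V}, exists c : V -> C, #|V1| = m /\
    {in V1, forall v, 8 * #|[set y in ~: V1 | col v y != c v]| <= #|V|}.
Proof.
move=> t_gt0; elim: m => [|m IH] leV.
  by exists set0, (fun v => col v v); rewrite cards0; split=> // v; rewrite inE.
have [|V1 [c [cV1 domV1]]] := IH; first by apply: leq_trans leV; rewrite leq_add2l.
have := cardsC V1; rewrite cV1 => cC.
have [|x xV1 [a dom]] := @dominated_vertex (~: V1) t_gt0; first by lia.
rewrite inE in xV1.
exists (x |: V1), (fun v => if v == x then a else c v); split; first by rewrite cardsU1 xV1 cV1.
have mono v b : #|[set y in ~: (x |: V1) | col v y != b]| <= #|[set y in ~: V1 | col v y != b]|.
  by apply: subset_leq_card; apply/subsetP => y; rewrite !inE negb_or => /andP[/andP[_ ->] ->].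
move=> v; rewrite !inE => /orP[/eqP->|vV1].
  rewrite eqxx; apply: leq_trans (leq_mul (leqnn 8) (mono _ _)) _; lia.
rewrite ifN; last by apply: contraNneq xV1 => <-.
exact: leq_trans (leq_mul (leqnn 8) (mono _ _)) (domV1 _ vV1).
Qed.

(** * The hub: small fibres *)

Section Hub.
Variables (V1 : {set V}) (c : V -> C).
Hypothesis hubP :
  {in V1, forall v, 4 * #|[set y in ~: V1 | col v y != c v]| <= #|~: V1|}.
Hypothesis hub_s : 8 * s <= #|~: V1|.
Hypothesis hub_t : 4 * t <= #|~: V1|.

(** Double counting in colour [a]: each vertex of the fibre reaches 3/4 of the complement of [V1],
    while sparseness bounds the degree sum on their union. *)
Lemma fibre_card a : #|[set v in V1 | c v == a]| <= 4 * s.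
Proof.
set F := [set v in V1 | c v == a]; set Y := ~: V1.
have Y_gt0 : 0 < #|Y| by apply: leq_trans hub_s; rewrite muln_gt0.
have FY : [disjoint F & Y].
  by apply/pred0P => v; rewrite /= !inE; case: (v \in V1); rewrite ?andbF.
have cFY : #|F :|: Y| = #|F| + #|Y|.
  by apply/eqP; rewrite (leq_card_setU F Y).2.
have := color_sparse a (F :|: Y); rewrite cFY.
have : 4 * \sum_(x in F :|: Y) deg [rel x y | (x != y) && (col x y == a)] (F :|: Y) x
    >= 3 * #|Y| * #|F|.
  rewrite [3 * _ * _]mulnC -sum_nat_const big_distrr /=.
  rewrite [leqRHS](big_setID F) /= setUK; apply: leq_trans (leq_addr _ _).
  apply: leq_sum => x; rewrite inE => /andP[xV1 /eqP cx].
  have nb := hubP xV1; rewrite -/Y cx in nb.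
  have cY : #|Y :&: [set y | col x y == a]| + #|[set y in Y | col x y != a]| = #|Y|.
    rewrite -[RHS](cardsID [set y | col x y == a] Y); congr (_ + _).
    by apply: eq_card => y; rewrite !inE // andbC.
  have le : #|Y :&: [set y | col x y == a]| <=
      deg [rel x y | (x != y) && (col x y == a)] (F :|: Y) x; last first.
    by move: nb le; rewrite -cY; set m := deg _ _ _; lia.
  apply: subset_leq_card; apply/subsetP => y; rewrite !in_setI in_set => /andP[yY xya].
  rewrite in_set in_setU yY orbT /= xya andbT.
  by apply: contraTneq yY => <-; rewrite inE negbK.
move=> H1 H2.
have H3 : #|F| * (8 * s) <= #|F| * #|Y| by rewrite leq_mul2l hub_s orbT.
have : #|F| * (2 * #|Y|) <= 4 * s * (2 * #|Y|) by rewrite -muln2 in H2; nia.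
by rewrite leq_pmul2r // muln_gt0.
Qed.

Lemma fibres_card (R : seq C) : #|[set v in V1 | c v \in R]| <= 4 * s * size R.
Proof.
elim: R => [|a R IH] /=.
  by rewrite muln0 leqn0 cards_eq0; apply/eqP/setP => v; rewrite !inE andbF.
rewrite mulnS; apply: leq_trans (leq_add (fibre_card a) IH).
apply: leq_trans (leq_card_setU _ _); apply: subset_leq_card; apply/subsetP => v.
by rewrite !inE andb_orr.
Qed.

(** * Pieces and their linking into one rainbow path *)

Definition arc x y := col x y == c x.

(* A piece (u, z, zs) stands for the path u, z, zs, whose first edge is rogue
   (coloured neither c u nor c z) and whose other edges are arcs. *)
Definition piece : Type := (V * V * seq V)%type.
Implicit Types (p q : piece) (ps : seq piece).

Definition verts p := [:: p.1.1, p.1.2 & p.2].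
Definition rogue p := col p.1.1 p.1.2.
(** Besides the edge colours this lists [c] of the first and of the last vertex, reserved for the
    edges that link the piece to others. *)
Definition colors p := rogue p :: map c (verts p).

Arguments verts : simpl never.
Arguments colors : simpl never.

(** Distinctness of [colors] makes the first edge rogue and the vertices distinct. *)
Definition valid p :=
  [&& path arc p.1.2 p.2, all (mem V1) (verts p) & uniq (colors p)].

Definition family ps := all valid ps && uniq (flatten (map colors ps)).

Definition total ps := sumn (map (fun p => size (verts p)) ps).

Lemma arc_colors z zs : path arc z zs -> pairmap col z zs = map c (belast z zs).
Proof. by elim: zs z => //= y zs IH z /andP[/eqP-> /IH->]. Qed.

Lemma valid_uniq p : valid p -> uniq (verts p).
Proof. by case/and3P=> _ _; rewrite cons_uniq => /andP[_]; apply: map_uniq. Qed.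

Lemma mem_colors p x : x \in verts p -> c x \in colors p.
Proof. by move=> xp; rewrite in_cons map_f ?orbT. Qed.

Lemma flatten_colors p ps :
  flatten (map colors (p :: ps)) = colors p ++ flatten (map colors ps).
Proof. by []. Qed.

Lemma total_cons p ps : total (p :: ps) = size (verts p) + total ps.
Proof. by []. Qed.

Lemma family_consP p ps : reflect
  [/\ valid p, family ps & {in flatten (map colors ps), forall a, a \notin colors p}]
  (family (p :: ps)).
Proof.
rewrite [family (p :: ps)]/((valid p && all valid ps) &&
  uniq (colors p ++ flatten (map colors ps))) cat_uniq.
apply: (iffP andP).
  move=> [/andP[vp vps] /and3P[_ /hasPn nc u]]; split=> [//||a /nc //].
  by apply/andP.
move=> [vp /andP[vps u] nc]; have /and3P[_ _ up] := vp.
split; first by apply/andP.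
by apply/and3P; split=> //; apply/hasPn => a /nc.
Qed.

Lemma link p ps : family (p :: ps) -> size ps <= t ->
  exists w, [/\ rainbow p.1.1 w, (size w).+1 >= total (p :: ps),
    uniq (c p.1.1 :: pairmap col p.1.1 w)
      /\ {subset c p.1.1 :: pairmap col p.1.1 w <= flatten (map colors (p :: ps))},
    {in w, forall x, x \in V1 -> c x \in flatten (map colors (p :: ps))}
    & count (mem (~: V1)) w <= size ps].
Proof.
elim: ps p => [|p' ps IH] [[u z] zs].
  move=> /andP[/=/andP[vp _]] _ _; have /and3P[pz vV1 ucol] := vp; rewrite [_.2]/= in pz.
  have colE : pairmap col u (z :: zs) = col u z :: map c (belast z zs).
    by rewrite /= (arc_colors pz).
  have perm_col : subseq (col u z :: c u :: map c (belast z zs)) (colors (u, z, zs)).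
    have -> : colors (u, z, zs) = col u z :: c u :: map c (z :: zs) by [].
    rewrite (lastI z zs) map_rcons.
    by rewrite /= !eqxx subseq_rcons.
  have uc : uniq (c u :: pairmap col u (z :: zs)).
    rewrite colE; set L := map c _ in perm_col *.
    have /perm_uniq-> : perm_eq [:: c u, col u z & L] [:: col u z, c u & L].
      by rewrite (perm_catCA [:: c u] [:: col u z] L).
    exact: subseq_uniq perm_col ucol.
  exists (z :: zs); split.
  - apply/andP; split; last by case/andP: uc.
    exact: valid_uniq vp.
  - by rewrite /total /= addn0.
  - split=> // x; rewrite colE => x_in; rewrite /= cats0; apply: (mem_subseq perm_col).
    by move: x_in; rewrite !inE orbCA.
  - by move=> x xzs _; rewrite /= cats0; apply: mem_colors; rewrite in_cons xzs orbT.
  - rewrite leqn0; apply/eqP/eqP; rewrite -leqn0 leqNgt -has_count.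
    apply/hasPn => x xzs; rewrite !inE negbK.
    by move/allP: vV1; apply; rewrite inE xzs orbT.
move=> /family_consP[vp fam dis] les.
have [w [rw sw [uw cw] vw yw]] := IH p' fam (ltnW les).
set u' := p'.1.1 in rw uw cw *.
have u'V1 : u' \in V1 by have [/and3P[_ /andP[]]] := family_consP _ _ fam.
have /and3P[pz vV1 _] := vp; rewrite [_.2]/= in pz.
have /and3P[uV1 zV1 zsV1] := vV1; rewrite [_.2]/= in zsV1.
pose l := last z zs.
have lV1 : l \in V1.
  by have := mem_last z zs; rewrite -/l inE => /orP[/eqP->|/(allP zsV1)].
(* Each of [l] and [u'] misses at most a quarter of the complement of [V1], and [w] occupies less
   than a quarter. *)
have [y] : exists y, [&& y \in ~: V1, y \notin w, col l y == c l & col u' y == c u'].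
  apply/existsP; apply: contraT; rewrite negb_exists => /forallP H.
  have sub : ~: V1 \subset [set x in w | x \in ~: V1]
      :|: ([set y in ~: V1 | col l y != c l] :|: [set y in ~: V1 | col u' y != c u']).
    apply/subsetP => y; rewrite in_setC => yV1; have := H y.
    by rewrite !in_setU !in_set yV1 /= !negb_and negbK andbT.
  have cover := leq_trans (subset_leq_card sub) (leq_trans (leq_card_setU _ _)
    (leq_add (leqnn _) (leq_card_setU _ _))).
  have cw' : #|[set x in w | x \in ~: V1]| <= size ps.
    apply: leq_trans yw; rewrite -size_filter; apply: leq_trans (card_size _).
    by apply: subset_leq_card; apply/subsetP => x; rewrite inE mem_filter andbC.
  have tight n a b1 b2 k r : n <= a + (b1 + b2) -> a <= k -> k < r ->
    4 * r <= n -> 4 * b1 <= n -> 4 * b2 <= n -> false by clear; lia.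
  exact: tight cover cw' les hub_t (hubP lV1) (hubP u'V1).
case/and4P=> yV1 yw' /eqP ly /eqP u'y.
have lc : colors (u, z, zs) = col u z :: c u :: rcons (map c (belast z zs)) (c l).
  by rewrite /colors /verts /= -map_rcons -lastI.
pose W := z :: zs ++ y :: u' :: w.
have colE : pairmap col u W
    = col u z :: rcons (map c (belast z zs)) (c l) ++ (c u' :: pairmap col u' w).
  by rewrite /W /= pairmap_cat (arc_colors pz) /= -/l ly (col_sym y) u'y cat_rcons.
have permE : perm_eq (c u :: pairmap col u W) (colors (u, z, zs) ++ (c u' :: pairmap col u' w)).
  rewrite colE lc; set L := rcons _ _ ++ _.
  by rewrite (perm_catCA [:: c u] [:: col u z] L).
have [_ _ ucol] := and3P vp.
have uW : uniq (c u :: pairmap col u W).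
  rewrite (perm_uniq permE) cat_uniq ucol uw andbT.
  by apply/hasPn => a /cw /dis.
have cV x : x \in u' :: w -> x \in V1 -> c x \in flatten (map colors (p' :: ps)).
  rewrite inE => /orP[/eqP-> _|]; last exact: vw.
  rewrite flatten_colors mem_cat mem_colors //.
  exact: mem_head.
exists W; split.
- apply/andP; split; last by case/andP: uW.
  rewrite -[u :: W]/(verts (u, z, zs) ++ [:: y, u' & w]) cat_uniq valid_uniq // cons_uniq.
  have yu' : y != u' by apply: contraTneq yV1 => ->; rewrite inE negbK.
  rewrite in_cons negb_or yu' yw'; have [uu'w _] := andP rw; rewrite uu'w !andbT.
  apply/hasPn => x; rewrite in_cons => /orP[/eqP->|xw].
    by apply: contraL yV1 => /(allP vV1); rewrite in_setC negbK.
  apply/negP => xp; have xV1 := allP vV1 _ xp.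
  by have /negP := dis _ (cV _ xw xV1); apply; apply: mem_colors.
- have -> : (size W).+1 = size (verts (u, z, zs)) + size [:: y, u' & w] by rewrite -size_cat.
  by rewrite total_cons leq_add2l (leq_trans sw).
- split=> // a; rewrite (perm_mem permE) mem_cat flatten_colors => a_in.
  by rewrite mem_cat; case/orP: a_in => [->|/cw ->] //; rewrite orbT.
- move=> x xW xV1.
  have : x \in verts (u, z, zs) ++ y :: u' :: w by rewrite in_cons xW orbT.
  rewrite mem_cat flatten_colors mem_cat.
  case/orP=> [xp|]; first by rewrite mem_colors.
  rewrite inE => /orP[/eqP xy|xw]; first by move: yV1; rewrite inE -xy xV1.
  by rewrite cV ?orbT.
- have nu' : (u' \in ~: V1) = false by rewrite in_setC u'V1.
  have c0 : count (mem (~: V1)) (z :: zs) = 0.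
    apply/eqP; rewrite -leqn0 leqNgt -has_count; apply/hasPn => x xz.
    by rewrite !inE negbK; apply: (allP vV1); rewrite in_cons xz orbT.
  by rewrite /W -cat_cons count_cat c0 /= yV1 nu'.
Qed.

(** By induction the later pieces have total below [t], so they are few enough for [link], whose
    rainbow path has at least [total] vertices. *)
Lemma total_lt ps : 0 < t -> family ps -> total ps < t.
Proof.
move=> t_gt0; elim: ps => // p ps IH fam.
have [_ fps _] := family_consP _ _ fam.
have ltps : size ps <= t.
  apply: leq_trans (ltnW (IH fps)); elim: (ps) => // q qs IHq.
  by rewrite total_cons /= -add1n leq_add.
have [w [rw sw _ _ _]] := link fam ltps.
exact: leq_ltn_trans sw (rainbow_short rw).
Qed.

Lemma size_total ps : 2 * size ps <= total ps.
Proof. by elim: ps => // p ps IH; rewrite total_cons mulnS leq_add. Qed.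

(* Removing the fibres of the colours of a maximal family of rogue edges leaves
   a set in which rogue colours and vertex colours are disjoint. *)
Lemma rogue_colors : 0 < t -> exists2 R : seq C, 2 * size R <= 3 * t &
  {in V1 &, forall u z, c u \notin R -> c z \notin R -> c u != c z ->
     [|| arc u z, arc z u | col u z \in R]}.
Proof.
move=> t_gt0.
(* An empty tail leaves a single rogue edge, with two vertices and three colours; hence the ratio in
   the bound on [R]. *)
pose single ps := all (fun p => p.2 == [::]) ps.
suff H n ps : family ps -> single ps -> t - size ps <= n -> exists2 qs,
    family qs /\ single qs & {in V1 &, forall u z,
     c u \notin flatten (map colors qs) -> c z \notin flatten (map colors qs) ->
     c u != c z -> [|| arc u z, arc z u | col u z \in flatten (map colors qs)]}.
  have [//|//||qs [fqs sqs] Hqs] := H t [::]; first by rewrite subn0.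
  exists (flatten (map colors qs)) => //.
  have := total_lt t_gt0 fqs; have := size_total qs.
  have -> : size (flatten (map colors qs)) = 3 * size qs; last lia.
  elim: (qs) sqs => // p ps' IH /andP[/eqP p2 /IH H'].
  by rewrite flatten_colors size_cat H' mulnS /colors /verts p2.
elim: n ps => [|n IH] ps fam sing len.
  have := total_lt t_gt0 fam; have := size_total ps; lia.
have [/exists_inP[u uV1 /exists_inP[z zV1 /and5P[uR zR uz nuz /andP[nzu colR]]]]|no] :=
    boolP [exists u in V1, exists z in V1, [&& c u \notin flatten (map colors ps),
      c z \notin flatten (map colors ps), c u != c z, ~~ arc u z, ~~ arc z u &
      col u z \notin flatten (map colors ps)]]; last first.
  exists ps => // u z uV1 zV1 uR zR uz; apply: contraT.
  rewrite !negb_or => /and3P[nuz nzu colR]; case/exists_inP: no; exists u => //.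
  by apply/exists_inP; exists z => //; apply/and5P; split=> //; apply/andP.
apply: (IH ((u, z, [::]) :: ps)).
- apply/family_consP; split=> //.
    rewrite /valid /= uV1 zV1 /colors /verts /rogue /= !inE !negb_or uz.
    by move: nuz nzu; rewrite /arc (col_sym z) => -> ->.
  move=> a a_in; rewrite /colors /verts /rogue /= !inE !negb_or.
  by apply/and3P; split; apply: contraTneq a_in => ->.
- by apply/andP.
- by rewrite /=; lia.
Qed.

(** The largest power counted is at most [m], and the smaller ones sum to less than it. *)
Lemma dyadic_sum e m : \sum_(i < e) (if 2 ^ i <= m then 2 ^ i else 0) <= 2 * m.
Proof.
elim: e => [|e IH]; first by rewrite big_ord0.
rewrite big_ord_recr /=; case: ifP => [le_m|_]; last by rewrite addn0.
have : \sum_(i < e) (if 2 ^ i <= m then 2 ^ i else 0) <= \sum_(i < e) 2 ^ i.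
  by apply: leq_sum => i _; case: ifP.
have : \sum_(i < e) 2 ^ i < 2 ^ e; last first.
  move=> lt le1; rewrite mul2n -addnn leq_add //.
  exact: leq_trans (ltnW (leq_ltn_trans le1 lt)) le_m.
elim: e {IH le_m} => [|e IH]; first by rewrite big_ord0.
by rewrite big_ord_recr /= expnS mul2n -addnn ltn_add2r.
Qed.

Lemma longest (P : piece -> Prop) B : (exists p, P p) ->
    (forall p, P p -> size p.2 <= B) ->
  exists2 p, P p & forall q, P q -> size q.2 <= size p.2.
Proof.
elim: B => [|B IH] exP leB.
  by case: exP => p Pp; exists p => // q /leB; rewrite leqn0 => /eqP->.
have [[p Pp eqB]|noB] := classic (exists2 p, P p & size p.2 = B.+1).
  by exists p => // q; rewrite eqB; apply: leB.
apply: IH => // p Pp; rewrite -ltnS ltn_neqAle leB // andbT.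
by apply/eqP => eqB; apply: noB; exists p.
Qed.

(** * Greedy choice of disjoint pieces *)

Section Rogue.
Variables (V2 : {set V}) (R : seq C).
Hypothesis V2_sub : V2 \subset V1.
Hypothesis V2_R : {in V2, forall v, c v \notin R}.
Hypothesis rogueP : {in V2 &, forall u z, c u != c z ->
  [|| arc u z, arc z u | col u z \in R]}.

Lemma colors_inv p : valid p ->
  [/\ rogue p \notin map c (verts p), c p.1.1 != c p.1.2 & uniq (map c (verts p))].
Proof.
case/and3P=> _ _; rewrite cons_uniq => /andP[nr uc]; split=> //.
by move: uc; rewrite /verts map_cons cons_uniq inE negb_or => /andP[/andP[]].
Qed.

Lemma rogue_in p : valid p -> {subset verts p <= V2} -> rogue p \in R.
Proof.
move=> vp pV2; have [nr cuz _] := colors_inv vp.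
have uV2 : p.1.1 \in V2 by apply: pV2; rewrite mem_head.
have zV2 : p.1.2 \in V2 by apply: pV2; rewrite !inE eqxx orbT.
have := rogueP uV2 zV2 cuz; rewrite /arc (col_sym p.1.2).
move: nr; rewrite /verts !map_cons !inE !negb_or => /and3P[nu nz _].
by rewrite -/(rogue p) (negPf nu) (negPf nz).
Qed.

(* Choosing longest pieces first, every piece left over is no longer than the
   chosen piece with the same rogue colour. *)
Lemma greedy n (Z : {set V}) (X : seq C) : Z \subset V2 -> #|Z| <= n ->
  exists ps, [/\ family ps,
    {in ps, forall p, {subset verts p <= Z} /\ rogue p \notin X} &
    forall q, valid q -> {subset verts q <= Z} -> rogue q \notin X ->
      {in ps, forall p, {in verts q, forall v, c v \notin map c (verts p)}} ->
      exists2 p, p \in ps & rogue p = rogue q /\ size q.2 <= size p.2].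
Proof.
elim: n Z X => [|n IH] Z X ZV2 leZ.
  exists [::]; split=> // q _ qZ.
  have := qZ _ (mem_head _ _); rewrite (_ : Z = set0) ?inE //.
  by apply/eqP; rewrite -cards_eq0 -leqn0.
pose P q := [/\ valid q, {subset verts q <= Z} & rogue q \notin X].
have [exP|noP] := classic (exists q, P q); last first.
  by exists [::]; split=> // q vq qZ qX; case: noP; exists q.
have [p [vp pZ pX] maxp] : exists2 p, P p & forall q, P q -> size q.2 <= size p.2.
  apply: (@longest _ #|V|) => // q [/valid_uniq uq _ _].
  have := uniq_leq_size uq (s2 := enum V); rewrite -cardE /verts /=.
  by move=> le; apply: ltnW; apply: ltnW; apply: le => x; rewrite mem_enum.
(* Whole fibres are removed, so later pieces share no vertex colour with [p]. *)
pose Z' := [set v in Z | c v \notin map c (verts p)].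
have Z'Z v : v \in Z' -> v \in Z by rewrite inE => /andP[].
have pV2 : {subset verts p <= V2} by move=> v /pZ /(subsetP ZV2).
have [||ps [fps psZ maxps]] := IH Z' (rogue p :: X).
- by apply/subsetP => v /Z'Z /(subsetP ZV2).
- rewrite -ltnS; apply: leq_trans leZ; apply: proper_card; apply/properP; split.
    by apply/subsetP.
  exists p.1.1; first by apply: pZ; rewrite mem_head.
  by rewrite inE map_f ?andbF // mem_head.
exists (p :: ps); split.
- apply/family_consP; split=> // a /flattenP[_ /mapP[q qps ->]].
  have [qZ qX] := psZ _ qps.
  have vq : valid q by have /andP[/allP fps1 _] := fps; apply: fps1.
  have qV2 : {subset verts q <= V2} by move=> v /qZ /Z'Z /(subsetP ZV2).
  (* A rogue colour never equals a vertex colour: the former lies in [R], the latter does not. *)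
  rewrite in_cons => /orP[/eqP->|/mapP[v vq1 ->]]; rewrite in_cons negb_or.
    move: qX; rewrite in_cons negb_or => /andP[-> _]; rewrite andTb.
    apply/mapP => -[v vp1 rv]; have := V2_R (pV2 _ vp1); rewrite -rv.
    by rewrite rogue_in.
  have := qZ _ vq1; rewrite inE => /andP[_ ->]; rewrite andbT.
  apply/eqP => cv; have := V2_R (qV2 _ vq1); rewrite cv.
  by rewrite rogue_in.
- move=> q; rewrite in_cons => /orP[/eqP->//|/psZ[qZ qX]].
  split; first by move=> v /qZ/Z'Z.
  by move: qX; rewrite in_cons negb_or => /andP[].
- move=> q vq qZ qX qfree.
  have [rq|nrq] := eqVneq (rogue q) (rogue p).
    by exists p; rewrite ?mem_head //; split=> //; apply: maxp.
  have [|||q' q'ps ?] := maxps q vq.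
  + move=> v vq1; rewrite inE qZ //=.
    by apply: (qfree p) => //; apply: mem_head.
  + by rewrite in_cons negb_or nrq.
  + by move=> q' q'ps; apply: qfree; rewrite in_cons q'ps orbT.
  + by exists q'; rewrite // in_cons q'ps orbT.
Qed.

(** * Directed paths of dyadic lengths *)

Section Heights.
Variables (Vs : {set V}) (ps : seq piece).
Hypothesis Vs_sub : Vs \subset V2.
Hypothesis ps_max : forall q, valid q -> {subset verts q <= Vs} ->
  exists2 p, p \in ps & rogue p = rogue q /\ size q.2 <= size p.2.

(* The directed path is required to survive the loss of any one fibre, so that
   it can be prolonged backwards by a rogue edge to any vertex. *)
Definition high L := [set v in Vs | [forall u, [exists zs : L.-tuple V,
  [&& path arc v zs, all (mem Vs) zs, uniq (map c (v :: zs)) & c u \notin map c zs]]]].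

Definition nlong L := count (fun p => L <= size p.2) ps.

Lemma high0 : high 0 = Vs.
Proof.
apply/setP => v; rewrite inE; case: (v \in Vs) => //=.
by apply/forallP => u; apply/existsP; exists [tuple].
Qed.

(** In the lost set [B], a set independent for the sparse graph [h] has distinct vertex colours and
    is a tournament under [arc]. With more than [4 * L.+1] vertices it would contain, by [redei] in
    a large out-neighbourhood, a directed path placing its start in [high L.*2.+1]. *)
Lemma high_step L :
  #|high L| <= #|high L.*2.+1| + L.+1 * (20 * s + 8 * s * nlong L).
Proof.
set B := high L :\: high L.*2.+1.
have VsV1 v : v \in Vs -> v \in V1 by move=> /(subsetP Vs_sub)/(subsetP V2_sub).
have BVs v : v \in B -> v \in Vs by rewrite !inE => /and3P[].
pose RL := map rogue [seq p <- ps | L <= size p.2].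
have sRL : size RL = nlong L by rewrite size_map size_filter.
pose h x y := [&& x \in V1, y \in V1 & c x == c y] || (x != y) && (col x y \in RL).
have h_sym : symmetric h.
  by move=> x y; rewrite /h andbCA [c x == _]eq_sym [x == y]eq_sym col_sym.
have h_sparse : sparse h (4 * s + s.*2 * size RL).
  apply: sparseU; last exact: colors_sparse.
  apply: sparse_deg => x; apply: leq_trans (fibre_card (c x)).
  by apply: subset_leq_card; apply/subsetP => y; rewrite !inE [c y == _]eq_sym => /and3P[_ -> ->].
have [I [IB indI cI]] := indep_set B h_sym h_sparse.
have IVs v : v \in I -> v \in Vs by move=> /(subsetP IB)/BVs.
have c_inj : {in I &, injective c}.
  move=> x y xI yI cxy; apply/eqP; apply: contraT => xy.
  by have := indI _ _ xI yI xy; rewrite /h !VsV1 ?IVs // cxy eqxx.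
have tour : {in I &, forall x y, x != y -> arc x y || arc y x}.
  move=> x y xI yI xy.
  have cxy : c x != c y by apply: contra xy => /eqP/c_inj->.
  have := indI _ _ xI yI xy; rewrite /h negb_or xy => /andP[_]; apply: contraR => noarc.
  have [nxy nyx] : ~~ arc x y /\ ~~ arc y x by apply/andP; rewrite -negb_or.
  have xyR : col x y \in R.
    have xV2 := subsetP Vs_sub _ (IVs _ xI); have yV2 := subsetP Vs_sub _ (IVs _ yI).
    by have := rogueP xV2 yV2 cxy; rewrite (negPf nxy) (negPf nyx).
  (* From [y] runs a directed path avoiding the colour [c x]. The rogue edge from [x] in front makes
     it a valid piece, so [ps_max] puts [col x y] in [RL]. *)
  have : y \in high L by have := subsetP IB _ yI; rewrite inE => /andP[].
  rewrite inE => /andP[yVs /forallP/(_ x)/existsP[zs /and4P[pzs zsVs uzs xzs]]].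
  have vq : valid (x, y, val zs).
    apply/and3P; split=> //.
      rewrite /verts /= !VsV1 ?IVs //=; apply/allP => z /(allP zsVs) zVs.
      exact: VsV1.
    have -> : colors (x, y, val zs) = [:: col x y, c x & map c (y :: zs)] by [].
    rewrite cons_uniq cons_uniq uzs andbT map_cons !in_cons !negb_or cxy xzs !andbT.
    apply/and3P; split=> //; first by move: nyx; rewrite /arc (col_sym y).
    apply/mapP => -[z zzs rz]; have := V2_R (subsetP Vs_sub _ (allP zsVs _ zzs)).
    by rewrite -rz xyR.
  have [|p pps [rp szp]] := ps_max vq.
    move=> z; rewrite !in_cons => /or3P[/eqP->|/eqP->|/(allP zsVs)//]; exact: IVs.
  apply/mapP; exists p; last by rewrite rp.
  by rewrite mem_filter pps andbT -(size_tuple zs).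
have lt_I : #|I| <= 4 * L.+1.
  rewrite leqNgt; apply/negP => I_big.
  have [v vI out_v] := max_outdegree (leq_ltn_trans (leq0n _) I_big) tour.
  set O := [set y in I :\ v | arc v y] in out_v.
  have : v \in B by apply: (subsetP IB).
  rewrite in_setD => /andP[/negP nhigh _]; apply: nhigh.
  rewrite inE IVs //=; apply/forallP => u.
  pose O' := [set y in O | c y != c u].
  (* The out-degree is at least 2L+2, and the fibre of [u] meets [I] at most once. *)
  have cO' : L.*2.+1 <= #|O'|.
    have := cardsID [set y | c y == c u] O.
    have -> : O :\: [set y | c y == c u] = O'.
      by apply/setP => y; rewrite in_setD !in_set andbC.
    have : #|O :&: [set y | c y == c u]| <= 1.
      apply/card_le1_eqP => x y; rewrite !inE => /andP[/andP[/andP[_ xI] _] /eqP cx].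
      by move=> /andP[/andP[/andP[_ yI] _] /eqP cy]; apply: c_inj; rewrite // cx.
    by clear -out_v I_big; lia.
  have O'P y : y \in O' -> [/\ y \in I, y != v, arc v y & c y != c u].
    by rewrite !inE -!andbA => /and4P[].
  have [|zs perm_zs sorted_zs] := redei (enum_uniq O') (arc := arc).
    move=> x y; rewrite !mem_enum => /O'P[xI _ _ _] /O'P[yI _ _ _]; exact: tour.
  have zsO' z : z \in zs -> z \in O' by rewrite (perm_mem perm_zs) mem_enum.
  have path_zs : path arc v zs.
    case: zs sorted_zs zsO' {perm_zs} => //= z zs -> zsO'.
    by have [_ _ -> _] := O'P _ (zsO' _ (mem_head _ _)).
  have sz : size (take L.*2.+1 zs) == L.*2.+1.
    by rewrite size_takel // (perm_size perm_zs) -cardE.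
  apply/existsP; exists (Tuple sz); apply/and4P; split.
  - exact: take_path.
  - by apply/allP => z /mem_take/zsO'/O'P[zI _ _ _]; apply: IVs.
  - have sub z : z \in v :: take L.*2.+1 zs -> z \in I.
      by rewrite in_cons => /orP[/eqP->//|/mem_take/zsO'/O'P[]].
    suff : uniq (map c (v :: take L.*2.+1 zs)) by [].
    rewrite map_inj_in_uniq.
      rewrite cons_uniq take_uniq ?(perm_uniq perm_zs) ?enum_uniq // andbT.
      by apply/negP => /mem_take/zsO'/O'P[_ /eqP].
    by move=> x y /sub xI /sub yI; apply: c_inj.
  - apply/mapP => -[z /mem_take/zsO'/O'P[_ _ _ cz] cuz].
    by rewrite cuz eqxx in cz.
have cB : #|high L| <= #|high L.*2.+1| + #|B|.
  by rewrite -(cardsID (high L.*2.+1) (high L)) leq_add2r subset_leq_card // subsetIr.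
apply: leq_trans cB _; rewrite leq_add2l; apply: leq_trans cI _.
apply: leq_trans (leq_mul (leqnn _) lt_I) _.
rewrite mulnA mulnC leq_mul2l /= sRL -muln2.
have arith a k : 0 < a -> (4 * a + a * 2 * k).+1 * 4 <= 20 * a + 8 * a * k by clear; lia.
exact: arith.
Qed.

(** The edge colours of a directed path are the colours [c] of its vertices except the last, here
    distinct, so the path is rainbow. *)
Lemma high_short L : high L != set0 -> L.+1 < t.
Proof.
case/set0Pn=> v; rewrite inE => /andP[_ /forallP/(_ v)/existsP[zs]].
case/and4P=> pzs _ uzs _; rewrite -(size_tuple zs); apply: (@rainbow_short v).
rewrite /rainbow (map_uniq uzs) (arc_colors pzs) /=.
by move: uzs; rewrite lastI map_rcons rcons_uniq => /andP[].
Qed.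

(** Summing piece by piece, a tail of length m counts at the levels with 2^i at most m+1,
    contributing at most 2(m+1). *)
Lemma sum_nlong e : \sum_(i < e) 2 ^ i * nlong (2 ^ i).-1 <= 2 * total ps.
Proof.
rewrite /nlong; elim: (ps) => [|p qs IH] /=.
  by rewrite big1 // => i _; rewrite muln0.
under eq_bigr => i _ do rewrite mulnDr.
rewrite big_split /= total_cons mulnDr leq_add //.
apply: leq_trans (leq_trans (dyadic_sum e (size p.2).+1) _).
  apply: leq_sum => i _.
  have -> : ((2 ^ i).-1 <= size p.2) = (2 ^ i <= (size p.2).+1).
    by rewrite -ltnS prednK ?expn_gt0.
  by case: ifP; rewrite ?muln1 ?muln0.
by rewrite leq_mul2l /verts /= leqnSn.
Qed.

Lemma Vs_card : 1 < t -> #|Vs| <= 40 * s * t + 16 * s * total ps.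
Proof.
move=> t_gt1; pose e := up_log 2 t.
have [e_gt0 /andP[lt_t le_t]] : 0 < e /\ 2 ^ e.-1 < t <= 2 ^ e.
  by split; [rewrite up_log_gt0 | apply: up_log_bounds].
(* Iterate [high_step] along L = 2^n - 1, for which 2L+1 = 2^(n+1) - 1, starting from
   [high 0 = Vs]. *)
have sum_high n : #|Vs| <= #|high (2 ^ n).-1| +
    (20 * s * 2 ^ n + 8 * s * \sum_(i < n) 2 ^ i * nlong (2 ^ i).-1).
  elim: n => [|n IH]; first by rewrite high0 leq_addr.
  apply: leq_trans IH _; rewrite big_ord_recr /=.
  have := high_step (2 ^ n).-1; rewrite prednK ?expn_gt0 //.
  have -> : (2 ^ n).-1.*2.+1 = (2 ^ n.+1).-1.
    by rewrite expnS mul2n -[in RHS](@prednK (2 ^ n)) ?expn_gt0 // doubleS.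
  have arith a b m k S : a <= b + m * (20 * s + 8 * s * k) ->
    a + (20 * s * m + 8 * s * S) <= b + (20 * s * (2 * m) + 8 * s * (S + m * k)) by clear; nia.
  by rewrite expnS; apply: arith.
(* At L = 2^e - 1, which is at least t - 1, [high_short] leaves no vertex. *)
have := sum_high e; rewrite (_ : high _ = set0) ?cards0; last first.
  apply/eqP; apply: contraT => /high_short.
  by rewrite prednK ?expn_gt0 // ltnNge le_t.
have le_e : 2 ^ e <= 2 * t by rewrite -(prednK e_gt0) expnS leq_mul2l ltnW.
move=> /leq_trans; apply; rewrite add0n leq_add //.
  by rewrite (_ : 40 * s * t = 20 * s * (2 * t)) ?leq_mul2l ?le_e ?orbT //; clear; lia.
rewrite (_ : 16 * s * total ps = 8 * s * (2 * total ps)); last by clear; lia.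
by rewrite leq_mul2l sum_nlong orbT.
Qed.

End Heights.

End Rogue.

(** * Counting all vertices *)

Lemma V1_card : 1 < t -> #|V1| <= 66 * s * t.
Proof.
move=> t_gt1; have t_gt0 := ltnW t_gt1.
have [R sR rogueR] := rogue_colors t_gt0.
pose V2 := [set v in V1 | c v \notin R].
have V2_sub : V2 \subset V1 by apply/subsetP => v; rewrite inE => /andP[].
have V2_R : {in V2, forall v, c v \notin R} by move=> v; rewrite inE => /andP[].
have rogueP : {in V2 &, forall u z, c u != c z -> [|| arc u z, arc z u | col u z \in R]}.
  by move=> u z; rewrite !inE => /andP[uV1 uR] /andP[zV1 zR]; apply: rogueR.
have [ps [fps psV2 maxps]] := greedy V2_R rogueP [::] (subxx V2) (leqnn _).
pose X := flatten (map (fun p => map c (verts p)) ps).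
have sX : size X = total ps.
  by rewrite /X /total; elim: (ps) => //= p qs IH; rewrite size_cat size_map IH.
pose Vs := [set v in V2 | c v \notin X].
have Vs_sub : Vs \subset V2 by apply/subsetP => v; rewrite inE => /andP[].
have le_Vs := @Vs_card V2 R V2_sub V2_R rogueP Vs ps Vs_sub _ t_gt1.
have {}le_Vs : #|Vs| <= 40 * s * t + 16 * s * total ps.
  apply: le_Vs => q vq qVs; apply: maxps => //; first by move=> v /qVs/(subsetP Vs_sub).
  move=> p pps v /qVs; rewrite inE => /andP[_]; apply: contra => cv.
  by apply/flattenP; exists (map c (verts p)) => //; apply/mapP; exists p.
have removed (W : {set V}) (Q : seq C) : W \subset V1 ->
    #|W| <= #|[set v in W | c v \notin Q]| + 4 * s * size Q.
  move=> WV1; rewrite -(cardsID [set v | c v \in Q] W) addnC leq_add //.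
    by apply: subset_leq_card; apply/subsetP => v; rewrite !inE andbC.
  apply: leq_trans (fibres_card Q); apply: subset_leq_card; apply/subsetP => v.
  by rewrite !inE => /andP[/(subsetP WV1)-> ->].
have := removed V1 R (subxx _); have := removed V2 X V2_sub.
rewrite -/V2 -/Vs sX; have := total_lt t_gt0 fps.
(* The 66 is 6 for the fibres of [R], 4 for those of [X], and 40 + 16 for [Vs]. *)
move: #|V1| #|V2| #|Vs| (total ps) (size R) sR le_Vs => a b d m r; clear; nia.
Qed.

End Hub.

Lemma card_neq : 1 < t -> #|V| != 1200 * s * t.
Proof.
move=> t_gt1; apply/eqP => cV; have t_gt0 := ltnW t_gt1.
have st_gt0 : 0 < s * t by rewrite muln_gt0 s_gt0.
(* Half of the vertices go to [V1], so an eighth of [V] is a quarter of the complement, as [hubP]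
   asks; and 600 exceeds 66. *)
have [|V1 [c [cV1 domV1]]] := @hub (600 * s * t) t_gt0; first by rewrite cV; lia.
have := cardsC V1; rewrite cV1 cV => cY.
have cVC : #|~: V1| = 600 * (s * t) by move: cY; clear; lia.
have : #|V1| <= 66 * s * t.
  apply: (@V1_card V1 c) => //; rewrite ?cVC.
  - by move=> v /domV1; rewrite cV; clear; lia.
  - by move: t_gt0; clear; nia.
  - by move: s_gt0; clear; nia.
by move: st_gt0; rewrite cV1; clear; lia.
Qed.

End Rainbow.

(** * Copies of [path_graph] and the final bound *)

Lemma rainbow_copy (N : nat) (C : eqType) (c : {set 'I_N} -> C) t x p :
    rainbow (fun x y => c [set x; y]) x p -> t <= (size p).+1 ->
  has_rainbow_copy (path_graph t) c.
Proof.
set col := fun x y => c [set x; y]; case/andP=> uxp ucol le_t.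
have lt_sz (i : 'I_t) : i < size (x :: p) by apply: leq_trans le_t.
pose phi (i : 'I_t) := nth x (x :: p) i.
have phi_inj : injective phi.
  by move=> i j /eqP; rewrite nth_uniq // => /eqP/val_inj.
have edgeP E : E \in edges (path_graph t) -> exists i j : 'I_t,
    [/\ j = i.+1 :> nat, E = [set i; j] & c (phi @: E) = nth (col x x) (pairmap col x p) i].
  have colE (i j : 'I_t) : j = i.+1 :> nat ->
      c (phi @: [set i; j]) = nth (col x x) (pairmap col x p) i.
    move=> ji; have lti : i < size p by rewrite -ltnS -ji.
    by rewrite imsetU1 imset_set1 (nth_pairmap x) // /phi ji.
  case/imset2P => i j _ /orP[/eqP ij|/eqP ji] ->.
    by exists i, j; split=> //; apply: colE.
  by exists j, i; rewrite setUC; split=> //; apply: colE.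
exists phi => // E F /edgeP[i [j [ji -> ->]]] /edgeP[i' [j' [ji' -> ->]]].
have lt_p (k l : 'I_t) : l = k.+1 :> nat -> k < size (pairmap col x p).
  by move=> lk; rewrite size_pairmap -ltnS -lk.
move/eqP; rewrite nth_uniq ?(lt_p _ _ ji) ?(lt_p _ _ ji') // => /eqP ii'.
have -> : i = i' by apply: val_inj.
by have -> : j = j' by apply: val_inj; rewrite /= ji ji' ii'.
Qed.

Theorem theorem1p4 :
  forall k : nat, 0 < k ->
  exists A : nat,
  forall (S : sgraph) (s t : nat), is_tree S -> #|S| = s -> 2 <= t ->
  exists2 N : nat, is_constrained_ramsey S (path_graph t) N
                 & N <= A * s * t * alpha k t.
Proof.
move=> k k_gt0; exists 1200 => S s t treeS cS t_gt1.
have s_gt0 : 0 < s by have [[]] := treeS; rewrite cS.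
have ramsey : constrained_ramsey_prop S (path_graph t) (1200 * s * t).
  move=> C c; have [|nomono] := classic (has_mono_copy S c); first by left.
  right; have [//|norainbow] := classic (has_rainbow_copy (path_graph t) c).
  pose col x y := c [set x; y].
  have col_sym x y : col x y = col y x by rewrite /col setUC.
  have sp a : sparse [rel x y | (x != y) && (col x y == a)] s.*2.
    exact: sparse_color treeS cS nomono.
  have := @card_neq _ _ col s t col_sym s_gt0 sp _ t_gt1.
  rewrite card_ord eqxx; case/(_ _)/negP => // x p rxp.
  by rewrite ltnNge; apply/negP => le_t; apply: norainbow; apply: rainbow_copy rxp le_t.
have [N [ramN minN]] : exists N, constrained_ramsey_prop S (path_graph t) N /\
    forall M, constrained_ramsey_prop S (path_graph t) M -> N <= M.
  elim/ltn_ind: (1200 * s * t) ramsey => n IH ramn.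
  have [[M ltM ramM]|nolt] := classic (exists2 M, M < n &
    constrained_ramsey_prop S (path_graph t) M); first exact: IH ramM.
  exists n; split=> // M ramM; rewrite leqNgt; apply/negP => ltM.
  by apply: nolt; exists M.
exists N; first by split.
apply: leq_trans (minN _ ramsey) _; rewrite leq_pmulr //.
by have /andP[] := alpha_bounds k_gt0 t_gt1.
Qed.
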